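(* Let $p\ge1$ be any integer (order $2p=2,4,6,\dots$), and apply the LCBC approach at a corner (defined in the context) to the operator $Q=\Delta=\partial_x^2+\partial_y^2$ on a Cartesian grid, with homogeneous boundary conditions (Dirichlet or Neumann on each of the two adjacent faces) and zero forcing in the PDE. Then, with the corner at grid index $(0,0)$ and the domain in the direction of increasing indices: (a) The ghost values on the adjacent faces obtained from the corner construction have odd symmetry for a Dirichlet face and even symmetry for a Neumann face: for the left face, $$U_{-\hat i,j}=-U_{\hat i,j}\ \text{ (Dirichlet)},\qquad U_{-\hat i,j}=U_{\hat i,j}\ \text{ (Neumann)},\qquad \hat i=1,\dots,p,\ j=0,\dots,p-1,$$ and similarly for the bottom face, $$U_{i,-\hat j}=-U_{i,\hat j}\ \text{ (Dirichlet)},\qquad U_{i,-\hat j}=U_{i,\hat j}\ \text{ (Neumann)},\qquad \hat j=1,\dots,p,\ i=0,\dots,p-1.$$ (b) The values at the corner ghost points satisfy, for $\hat i,\hat j=1,\dots,p$, $$U_{-\hat i,-\hat j}=U_{\hat i,\hat j}\quad\text{at Dirichlet-Dirichlet or Neumann-Neumann corners},$$ $$U_{-\hat i,-\hat j}=-U_{\hat i,\hat j}\quad\text{at Dirichlet-Neumann corners}.$$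
   Context: LCBC = Local Compatibility Boundary Condition. The PDE is $\mathcal Lu=Qu+f$ with $\mathcal Lu=0$, $\partial_tu$ or $\partial_t^2u$, on a rectangle with Cartesian grid spacings $\Delta x,\Delta y>0$; $f=0$ and boundary data are zero. $U_{i,j}$ is the grid function at a fixed time; its values at interior grid points and on Neumann boundaries are given arbitrary data, and it vanishes at grid points on homogeneous Dirichlet boundaries. Any corner is brought, by reflections and possibly interchange of $x$ and $y$ (which leave $\Delta$ invariant), to the bottom-left corner $(0,0)$ with the domain in $\{x>0,y>0\}$, left face $x=0$ and bottom face $y=0$; for a Dirichlet-Neumann corner the Dirichlet face is $x=0$ and the Neumann face is $y=0$. Let $V_p$ be the space of real polynomials in $(x,y)$ of degree at most $2p$ in each variable. LCBC approach at the corner: let $\tilde u\in V_p$ satisfy the following constraints (exact derivatives). Averaging rule: when two conditions $\ell_1(\tilde u)=0$ (from the left face) and $\ell_2(\tilde u)=0$ (from the bottom face) at level $\nu$ are said to be averaged, they are replaced by the single condition $\Delta y^{2\nu}\ell_1(\tilde u)+\Delta x^{2\nu}\ell_2(\tilde u)=0$. Dirichlet-Dirichlet corner: - $\tilde u(\hat i\Delta x,\hat j\Delta y)=U_{\hat i,\hat j}$ for $\hat i,\hat j=1,\dots,p$; - for $\nu=0,\dots,p$ and $\mu\in\{1,3,\dots,2\nu-1\}\cup\{2\nu,2\nu+1,\dots,2p\}$: $\partial_y^{\mu}Q^{\nu}\tilde u(0,0)=0$ and $\partial_x^{\mu}Q^{\nu}\tilde u(0,0)=0$, the pair with $\mu=2\nu$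 being averaged. Neumann-Neumann corner: - $\tilde u(\hat i\Delta x,\hat j\Delta y)=U_{\hat i,\hat j}$ for $\hat i,\hat j=0,\dots,p$; - for $\nu=0,\dots,p-1$ and $\mu\in\{0,2,\dots,2\nu\}\cup\{2\nu+1,\dots,2p\}$: $\partial_y^{\mu}\partial_xQ^{\nu}\tilde u(0,0)=0$ and $\partial_x^{\mu}\partial_yQ^{\nu}\tilde u(0,0)=0$, the pair with $\mu=2\nu+1$ being averaged. Dirichlet-Neumann corner (Dirichlet on $x=0$, Neumann on $y=0$): - $\tilde u(\hat i\Delta x,\hat j\Delta y)=U_{\hat i,\hat j}$ for $\hat i=1,\dots,p$, $\hat j=0,\dots,p$; - for $\nu=0,\dots,p-1$: $\partial_y^{\mu_1}Q^{\nu}\tilde u(0,0)=0$ for $\mu_1\in\{0,2,\dots,2\nu\}\cup\{2\nu+1,\dots,2p\}$ and $\partial_x^{\mu_2}\partial_yQ^{\nu}\tilde u(0,0)=0$ for $\mu_2\in\{1,3,\dots,2\nu-1\}\cup\{2\nu,\dots,2p\}$, the two conditions with $\mu_1=2\nu+1$, $\mu_2=2\nu$ being averaged; - for $\nu=p$: $\partial_y^{\mu_1}Q^{p}\tilde u(0,0)=0$ for $\mu_1\in\{0,2,\dots,2p\}$. The ghost values near the corner are then defined by $U_{\hat i,\hat j}:=\tilde u(\hat i\Delta x,\hat j\Delta y)$ for all ghost indices $-p\le\hat i,\hat j\le p-1$ with $\hat i<0$ or $\hat j<0$, and also $U_{-p,j}$, $U_{i,-p}$ in this range. *)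

(* Defs.v *)
From HB Require Import structures.
From mathcomp Require Import all_boot all_order all_algebra.
From mathcomp Require Import reals.
Set Implicit Arguments.
Unset Strict Implicit.
Unset Printing Implicit Defensive.

Import Order.TTheory GRing.Theory Num.Theory.
Local Open Scope ring_scope.

Inductive bc := Dirichlet | Neumann.

Section LCBC.
Variable R : realType.

(* A polynomial u(x, y) is encoded with x as the outer indeterminate and y as
   the inner one: the coefficient of x^i y^j is u`_i`_j. *)
Implicit Type u : {poly {poly R}}.

Definition eval2 u (x y : R) : R := u.[x%:P].[y].
Definition dX u : {poly {poly R}} := u^`().
Definition dY u : {poly {poly R}} := map_poly (@deriv R) u.
Definition laplacian u : {poly {poly R}} := dX (dX u) + dY (dY u).

Definition in_Vp (p : nat) u : Prop :=
  (size u <= (2 * p).+1)%N /\ forall i : nat, (size (u`_i)%R <= (2 * p).+1)%N.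

Definition grid_val (hx hy : R) u (i j : int) : R :=
  eval2 u (i%:~R * hx) (j%:~R * hy).

(* With the zero boundary condition differentiated in time by means of the PDE:
   u = 0 gives Q^nu u = 0 on a Dirichlet face and d_n u = 0 gives
   d_n Q^nu u = 0 on a Neumann face; these are the mu-th tangential derivatives
   of these conditions at the corner. *)
Definition dir_left (mu nu : nat) u : R :=
  eval2 (iter mu dY (iter nu laplacian u)) 0 0.
Definition dir_bottom (mu nu : nat) u : R :=
  eval2 (iter mu dX (iter nu laplacian u)) 0 0.
Definition neu_left (mu nu : nat) u : R :=
  eval2 (iter mu dY (dX (iter nu laplacian u))) 0 0.
Definition neu_bottom (mu nu : nat) u : R :=
  eval2 (iter mu dX (dY (iter nu laplacian u))) 0 0.

(* {1, 3, ..., 2 nu - 1} U {2 nu, ..., 2 p} *)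
Definition odd_range (p nu mu : nat) : bool :=
  (odd mu && (mu < 2 * nu)%N) || (2 * nu <= mu <= 2 * p)%N.
(* {0, 2, ..., 2 nu} U {2 nu + 1, ..., 2 p} *)
Definition even_range (p nu mu : nat) : bool :=
  (~~ odd mu && (mu <= 2 * nu)%N) || ((2 * nu).+1 <= mu <= 2 * p)%N.

(* l1 comes from the left face, l2 from the bottom face. *)
Definition averaged (hx hy : R) (nu : nat) (l1 l2 : R) : Prop :=
  hy ^+ (2 * nu) * l1 + hx ^+ (2 * nu) * l2 = 0.

Definition DD_constraints (p : nat) (hx hy : R) (U : int -> int -> R) u : Prop :=
  [/\ forall i j : nat, (1 <= i <= p)%N -> (1 <= j <= p)%N ->
        grid_val hx hy u i%:Z j%:Z = U i%:Z j%:Z,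
      forall nu mu : nat, (nu <= p)%N -> odd_range p nu mu -> mu <> (2 * nu)%N ->
        dir_left mu nu u = 0 /\ dir_bottom mu nu u = 0
    & forall nu : nat, (nu <= p)%N ->
        averaged hx hy nu (dir_left (2 * nu) nu u) (dir_bottom (2 * nu) nu u)].

Definition NN_constraints (p : nat) (hx hy : R) (U : int -> int -> R) u : Prop :=
  [/\ forall i j : nat, (i <= p)%N -> (j <= p)%N ->
        grid_val hx hy u i%:Z j%:Z = U i%:Z j%:Z,
      forall nu mu : nat, (nu < p)%N -> even_range p nu mu ->
        mu <> (2 * nu).+1 ->
        neu_left mu nu u = 0 /\ neu_bottom mu nu u = 0
    & forall nu : nat, (nu < p)%N ->
        averaged hx hy nu (neu_left (2 * nu).+1 nu u)
                          (neu_bottom (2 * nu).+1 nu u)].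

(* Dirichlet on the left face x = 0, Neumann on the bottom face y = 0. *)
Definition DN_constraints (p : nat) (hx hy : R) (U : int -> int -> R) u : Prop :=
  [/\ forall i j : nat, (1 <= i <= p)%N -> (j <= p)%N ->
        grid_val hx hy u i%:Z j%:Z = U i%:Z j%:Z,
      forall nu mu : nat, (nu < p)%N -> even_range p nu mu ->
        mu <> (2 * nu).+1 -> dir_left mu nu u = 0,
      forall nu mu : nat, (nu < p)%N -> odd_range p nu mu ->
        mu <> (2 * nu)%N -> neu_bottom mu nu u = 0,
      forall nu : nat, (nu < p)%N ->
        averaged hx hy nu (dir_left (2 * nu).+1 nu u) (neu_bottom (2 * nu) nu u)
    & forall mu : nat, ~~ odd mu -> (mu <= 2 * p)%N -> dir_left mu p u = 0].

(* The grid function U carries on the ghost points near the corner the values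
   of a polynomial of V_p subject to the constraints C. *)
Definition ghost_filled
    (C : nat -> R -> R -> (int -> int -> R) -> {poly {poly R}} -> Prop)
    (p : nat) (hx hy : R) (U : int -> int -> R) : Prop :=
  exists u, [/\ in_Vp p u, C p hx hy U u
    & forall i j : int, - p%:Z <= i <= p%:Z - 1 -> - p%:Z <= j <= p%:Z - 1 ->
        (i < 0) || (j < 0) -> U i j = grid_val hx hy u i j].

(* First argument of type bc: left face; second: bottom face. A corner with
   Neumann left and Dirichlet bottom is treated by interchanging x and y, which
   leaves the Laplacian invariant. *)
Definition lcbc_corner (bL bB : bc) (p : nat) (hx hy : R)
    (U : int -> int -> R) : Prop :=
  match bL, bB with
  | Dirichlet, Dirichlet => ghost_filled DD_constraints p hx hy U
  | Neumann, Neumann => ghost_filled NN_constraints p hx hy U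
  | Dirichlet, Neumann => ghost_filled DN_constraints p hx hy U
  | Neumann, Dirichlet => ghost_filled DN_constraints p hy hx (fun i j => U j i)
  end.

(* Homogeneous Dirichlet data; only the grid points within p cells of the
   corner matter. *)
Definition zero_dirichlet (bL bB : bc) (p : nat) (U : int -> int -> R) : Prop :=
  (bL = Dirichlet -> forall j : nat, (j <= p)%N -> U 0 j%:Z = 0) /\
  (bB = Dirichlet -> forall i : nat, (i <= p)%N -> U i%:Z 0 = 0).

End LCBC.

(* Main.v *)
(* Write D m n for the mixed derivatives of u at the corner.  Since
   Delta^nu = \sum_k 'C(nu, k) d_x^(2 k) d_y^(2 (nu - k)), every constraint only
   involves the D m n with fixed parities of m and n and a fixed total order,
   and for increasing nu the constraints are triangular in D.  Three of the four
   parity classes are thereby forced to vanish: in two of them the constraints of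
   one face suffice, and in the third the left face handles the entries on one
   side of the diagonal, the bottom face those on the other side, and the
   averaged constraints, whose two terms then reduce to the same derivative,
   those on the diagonal.  What remains is odd in the variable normal to a
   Dirichlet face and even in the variable normal to a Neumann face. *)
Require Import Defs.
From HB Require Import structures.
From mathcomp Require Import all_boot all_order all_algebra.
From mathcomp Require Import reals zify.
Set Implicit Arguments.
Unset Strict Implicit.
Unset Printing Implicit Defensive.

Import Order.TTheory GRing.Theory Num.Theory.
Local Open Scope ring_scope.

(** * Mixed derivatives at the corner under powers of the Laplacian *)

Section CornerDerivatives.
Variable R : realType.
Implicit Types (u : {poly {poly R}}) (G : nat -> nat -> R).

(** The factorials turn the coefficient into the derivative of order [m] in x and [n] in y at the
    origin, so that [dX] and [dY] act as pure index shifts. *)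
Definition corner_deriv u (m n : nat) : R := u`_m`_n * (m`! * n`!)%:R.

Lemma corner_deriv_eq0 u m n : (corner_deriv u m n == 0) = (u`_m`_n == 0).
Proof.
by rewrite mulf_eq0 pnatr_eq0 muln_eq0 !eqn0Ngt !fact_gt0 orbF.
Qed.

Lemma corner_deriv_dX u m n :
  corner_deriv (dX u) m n = corner_deriv u m.+1 n.
Proof.
rewrite /corner_deriv /dX coef_deriv coefMn factS.
by rewrite -[in LHS](mulr_natr _ m.+1) !natrM !mulrA.
Qed.

Lemma corner_deriv_dY u m n :
  corner_deriv (dY u) m n = corner_deriv u m n.+1.
Proof.
rewrite /corner_deriv /dY coef_map_id0 ?linear0 // coef_deriv factS.
by rewrite mulnCA -[in LHS](mulr_natr _ n.+1) !natrM !mulrA.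
Qed.

Lemma corner_deriv_laplacian u m n :
  corner_deriv (laplacian u) m n
  = corner_deriv u m.+2 n + corner_deriv u m n.+2.
Proof.
rewrite -!corner_deriv_dX -!corner_deriv_dY.
by rewrite /corner_deriv /laplacian !coefD mulrDl.
Qed.

Lemma corner_deriv_iter_dX u mu m n :
  corner_deriv (iter mu (@dX R) u) m n = corner_deriv u (mu + m) n.
Proof.
elim: mu m => [//|mu IH] m.
by rewrite iterS corner_deriv_dX IH addnS.
Qed.

Lemma corner_deriv_iter_dY u mu m n :
  corner_deriv (iter mu (@dY R) u) m n = corner_deriv u m (mu + n).
Proof.
elim: mu n => [//|mu IH] n.
by rewrite iterS corner_deriv_dY IH addnS.
Qed.

Lemma eval2_00 u : eval2 u 0 0 = corner_deriv u 0 0.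
Proof. by rewrite /eval2 polyC0 !horner_coef0 /corner_deriv mulr1. Qed.

Lemma dir_leftE mu nu u :
  dir_left mu nu u = corner_deriv (iter nu (@laplacian R) u) 0 mu.
Proof. by rewrite /dir_left eval2_00 corner_deriv_iter_dY addn0. Qed.

Lemma dir_bottomE mu nu u :
  dir_bottom mu nu u = corner_deriv (iter nu (@laplacian R) u) mu 0.
Proof. by rewrite /dir_bottom eval2_00 corner_deriv_iter_dX addn0. Qed.

Lemma neu_leftE mu nu u :
  neu_left mu nu u = corner_deriv (iter nu (@laplacian R) u) 1 mu.
Proof.
by rewrite /neu_left eval2_00 corner_deriv_iter_dY corner_deriv_dX addn0.
Qed.

Lemma neu_bottomE mu nu u :
  neu_bottom mu nu u = corner_deriv (iter nu (@laplacian R) u) mu 1.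
Proof.
by rewrite /neu_bottom eval2_00 corner_deriv_iter_dX corner_deriv_dY addn0.
Qed.

Lemma corner_deriv_iter_laplacian u nu m n :
  corner_deriv (iter nu (@laplacian R) u) m n
  = \sum_(k < nu.+1)
      corner_deriv u (2 * k + m) (2 * (nu - k) + n) *+ 'C(nu, k).
Proof.
elim: nu m n => [|nu IH] m n; first by rewrite big_ord1.
rewrite iterS corner_deriv_laplacian !IH.
rewrite [RHS]big_ord_recl bin0 [in RHS]/=.
(* Pascal's rule: the terms in ['C(nu, k.+1)], together with the one just split off, form the
   y-shifted sum; those in ['C(nu, k)] form the x-shifted sum. *)
under [X in _ = _ + X]eq_bigr => k _ do rewrite binS mulrnDr.
rewrite big_split /= addrA [LHS]addrC; congr (_ + _).
  rewrite [in RHS]big_ord_recr /= bin_small // mulr0n addr0.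
  rewrite big_ord_recl bin0 /=; congr (_ *+ _ + _).
    by congr corner_deriv; lia.
  by apply: eq_bigr => k _; congr (corner_deriv _ _ _ *+ _);
    have := ltn_ord k; rewrite /bump /=; lia.
by apply: eq_bigr => k _; congr (corner_deriv _ _ _ *+ _);
  rewrite /bump /=; lia.
Qed.

(** Counting the y-derivatives instead gives the bottom face the same triangular shape as the left
    one. *)
Lemma corner_deriv_iter_laplacian_rev u nu m n :
  corner_deriv (iter nu (@laplacian R) u) m n
  = \sum_(k < nu.+1)
      corner_deriv u (2 * (nu - k) + m) (2 * k + n) *+ 'C(nu, k).
Proof.
rewrite corner_deriv_iter_laplacian (reindex_inj rev_ord_inj) /=.
apply: eq_bigr => k _; have := ltn_ord k; rewrite ltnS => lek.
by rewrite subSS bin_sub // subKn.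
Qed.

(** * Triangular elimination within one parity class *)

(** Strong induction on [k]: the last term of the sum is [G k l] with coefficient 1, and the earlier
    ones lie on the same antidiagonal at smaller first index, where [S] still holds. *)
Lemma triangular_eq0 G (S : nat -> nat -> Prop) :
    (forall k l j, S k l -> (j < k)%N -> S j (k - j + l)%N) ->
    (forall k l, S k l ->
       \sum_(j < k.+1) G j (k - j + l)%N *+ 'C(k, j) = 0 \/ G k l = 0) ->
  forall k l, S k l -> G k l = 0.
Proof.
move=> Sdown eqG; elim/ltn_ind => k IH l Skl.
case: (eqG k l Skl) => //.
rewrite big_ord_recr /= subnn binn mulr1n big1 ?add0r // => j _.
by rewrite IH ?mul0rn //; exact: Sdown.
Qed.

Definition deriv_bounded (p : nat) u :=
  forall m n, (2 * p < m)%N || (2 * p < n)%N -> corner_deriv u m n = 0.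

Lemma in_Vp_deriv_bounded p u : in_Vp p u -> deriv_bounded p u.
Proof.
move=> [szu szc] m n /orP[lt|lt]; apply/eqP; rewrite corner_deriv_eq0.
  by rewrite (nth_default _ (leq_trans szu lt)) coef0.
by rewrite (nth_default _ (leq_trans (szc m) lt)).
Qed.

(** The entry at [(k, l)] is the last term of the level [k] constraint. Orders above [2 * p], for
    which no constraint is assumed, are killed by the degree bound. [S] will be a whole parity class
    or its half on one side of the diagonal. *)
Lemma left_face_eq0 p u a b (S : nat -> nat -> Prop) :
    deriv_bounded p u ->
    (forall k l j, S k l -> (j < k)%N -> S j (k - j + l)%N) ->
    (forall nu l, S nu l -> (2 * nu + a <= 2 * p)%N -> (2 * l + b <= 2 * p)%N ->
       corner_deriv (iter nu (@laplacian R) u) a (2 * l + b) = 0) ->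
  forall k l, S k l -> corner_deriv u (2 * k + a) (2 * l + b) = 0.
Proof.
move=> bdu Sdown equ.
pose G k l := corner_deriv u (2 * k + a) (2 * l + b).
apply: (@triangular_eq0 G) Sdown _ => k l Skl; rewrite /G.
have [lek|ltk] := leqP (2 * k + a) (2 * p); last by right; rewrite bdu ?ltk.
have [lel|ltl] := leqP (2 * l + b) (2 * p); last first.
  by right; rewrite bdu ?ltl ?orbT.
left; rewrite -[RHS](equ k l) // corner_deriv_iter_laplacian.
by apply: eq_bigr => j _; rewrite mulnDr addnA.
Qed.

Lemma bottom_face_eq0 p u a b (S : nat -> nat -> Prop) :
    deriv_bounded p u ->
    (forall k l j, S k l -> (j < k)%N -> S j (k - j + l)%N) ->
    (forall nu l, S nu l -> (2 * nu + b <= 2 * p)%N -> (2 * l + a <= 2 * p)%N ->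
       corner_deriv (iter nu (@laplacian R) u) (2 * l + a) b = 0) ->
  forall k l, S k l -> corner_deriv u (2 * l + a) (2 * k + b) = 0.
Proof.
move=> bdu Sdown equ.
pose G k l := corner_deriv u (2 * l + a) (2 * k + b).
apply: (@triangular_eq0 G) Sdown _ => k l Skl; rewrite /G.
have [lek|ltk] := leqP (2 * k + b) (2 * p); last first.
  by right; rewrite bdu ?ltk ?orbT.
have [lel|ltl] := leqP (2 * l + a) (2 * p); last by right; rewrite bdu ?ltl.
left; rewrite -[RHS](equ k l) // corner_deriv_iter_laplacian_rev.
by apply: eq_bigr => j _; rewrite mulnDr addnA.
Qed.

Lemma both_faces_eq0 p hx hy u a b :
    0 < hx -> 0 < hy -> deriv_bounded p u ->
    (forall nu l, (nu < l)%N ->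
       (2 * nu + a <= 2 * p)%N -> (2 * l + b <= 2 * p)%N ->
       corner_deriv (iter nu (@laplacian R) u) a (2 * l + b) = 0) ->
    (forall nu l, (nu < l)%N ->
       (2 * nu + b <= 2 * p)%N -> (2 * l + a <= 2 * p)%N ->
       corner_deriv (iter nu (@laplacian R) u) (2 * l + a) b = 0) ->
    (forall nu, (2 * nu + a <= 2 * p)%N -> (2 * nu + b <= 2 * p)%N ->
       averaged hx hy nu
         (corner_deriv (iter nu (@laplacian R) u) a (2 * nu + b))
         (corner_deriv (iter nu (@laplacian R) u) (2 * nu + a) b)) ->
  forall k l, corner_deriv u (2 * k + a) (2 * l + b) = 0.
Proof.
move=> hx0 hy0 bdu eql eqb eqd.
(* Lowering [k] along an antidiagonal moves away from the diagonal, so each open half can be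
   eliminated by its own face. *)
have lt_down k l j : (k < l)%N -> (j < k)%N -> (j < k - j + l)%N by lia.
have above := left_face_eq0 bdu lt_down eql.
have below := bottom_face_eq0 bdu lt_down eqb.
move=> k l; have [ltkl|ltlk|<-{l}] := ltngtP k l.
- exact: above.
- exact: below.
have [leka|ltka] := leqP (2 * k + a) (2 * p); last by rewrite bdu ?ltka.
have [lekb|ltkb] := leqP (2 * k + b) (2 * p); last by rewrite bdu ?ltkb ?orbT.
have := eqd k leka lekb; rewrite /averaged.
rewrite corner_deriv_iter_laplacian corner_deriv_iter_laplacian_rev.
rewrite !big_ord_recr /= subnn binn !mulr1n muln0 !add0n.
rewrite [X in _ * (X + _)]big1 => [|j _]; last first.
  by rewrite addnA -mulnDr above ?mul0rn //; have := ltn_ord j; lia.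
rewrite [X in _ + _ * (X + _)]big1 => [|j _]; last first.
  by rewrite addnA -mulnDr below ?mul0rn //; have := ltn_ord j; lia.
(* Both faces leave the same diagonal derivative; its total weight is a sum of powers of the
   spacings, hence positive. *)
rewrite !add0r -mulrDl => /eqP; rewrite mulf_eq0 => /orP[|/eqP //].
by rewrite gt_eqF // addr_gt0 ?exprn_gt0.
Qed.

End CornerDerivatives.

(** * Parity of the polynomial at each type of corner *)

Section Parity.
Variable R : realType.
Implicit Type u : {poly {poly R}}.

Definition has_parity (b1 b2 : bool) u :=
  forall m n, (odd m != b1) || (odd n != b2) -> u`_m`_n = 0.

Lemma has_parityP b1 b2 u :
    (forall c1 c2 : bool, (c1 != b1) || (c2 != b2) ->
       forall k l, corner_deriv u (2 * k + c1) (2 * l + c2) = 0) ->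
  has_parity b1 b2 u.
Proof.
move=> H m n mn; apply/eqP; rewrite -corner_deriv_eq0; apply/eqP.
rewrite -(odd_double_half m) -(odd_double_half n) -!mul2n.
by rewrite addnC [(odd n + _)%N]addnC; exact: H.
Qed.

(** General in [A] because it serves both the outer polynomial, over [{poly R}], and the inner one,
    over [R]. *)
Lemma horner_parity (A : comNzRingType) (q : {poly A}) (b : bool) x :
  (forall m, odd m != b -> q`_m = 0) -> q.[- x] = (-1) ^+ b * q.[x].
Proof.
move=> qb; rewrite !horner_coef mulr_sumr; apply: eq_bigr => i _.
have [ib|/qb->] := eqVneq (odd i) b; last by rewrite !mul0r mulr0.
by rewrite (exprNn x) -(signr_odd _ i) ib mulrCA.
Qed.

Lemma eval2_parity_x b1 b2 u x y :
  has_parity b1 b2 u -> eval2 u (- x) y = (-1) ^+ b1 * eval2 u x y.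
Proof.
move=> pu; rewrite /eval2 polyCN (@horner_parity _ _ b1) => [|m mb].
  by rewrite -(rmorph_sign polyC) hornerCM.
by apply/polyP => n; rewrite coef0 pu ?mb.
Qed.

Lemma eval2_parity_y b1 b2 u x y :
  has_parity b1 b2 u -> eval2 u x (- y) = (-1) ^+ b2 * eval2 u x y.
Proof.
move=> pu; apply: horner_parity => n nb.
rewrite horner_coef coef_sum big1 // => i _.
by rewrite -polyC_exp coefMC pu ?nb ?orbT // mul0r.
Qed.

(** Every odd tangential order occurs unaveraged, so one face settles each mixed class; even orders
    start only at [2 * nu], so the even-even class needs both faces. *)
Lemma DD_parity p hx hy U u : 0 < hx -> 0 < hy -> in_Vp p u ->
  DD_constraints p hx hy U u -> has_parity true true u.
Proof.
move=> hx0 hy0 /in_Vp_deriv_bounded bdu [_ cface cavg].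
apply: has_parityP => -[] [] //= _ k l.
- apply: (bottom_face_eq0 (S := fun _ _ => True) bdu) => // nu m _ h1 h2.
  rewrite -dir_bottomE.
  by apply: (cface _ _ _ _ _).2; rewrite /odd_range; lia.
- apply: (left_face_eq0 (S := fun _ _ => True) bdu) => // nu m _ h1 h2.
  rewrite -dir_leftE.
  by apply: (cface _ _ _ _ _).1; rewrite /odd_range; lia.
- apply: (both_faces_eq0 hx0 hy0 bdu) => [nu m lt h1 h2|nu m lt h1 h2|nu h1 h2].
  + rewrite -dir_leftE.
    by apply: (cface _ _ _ _ _).1; rewrite /odd_range; lia.
  + rewrite -dir_bottomE.
    by apply: (cface _ _ _ _ _).2; rewrite /odd_range; lia.
  + by rewrite addn0 -dir_leftE -dir_bottomE; apply: cavg; lia.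
Qed.

(** Here every even tangential order occurs unaveraged, and the odd-odd class is the one that needs
    both faces. *)
Lemma NN_parity p hx hy U u : 0 < hx -> 0 < hy -> in_Vp p u ->
  NN_constraints p hx hy U u -> has_parity false false u.
Proof.
move=> hx0 hy0 /in_Vp_deriv_bounded bdu [_ cface cavg].
apply: has_parityP => -[] [] //= _ k l.
- apply: (both_faces_eq0 hx0 hy0 bdu) => [nu m lt h1 h2|nu m lt h1 h2|nu h1 h2].
  + rewrite -neu_leftE.
    by apply: (cface _ _ _ _ _).1; rewrite /even_range; lia.
  + rewrite -neu_bottomE.
    by apply: (cface _ _ _ _ _).2; rewrite /even_range; lia.
  + by rewrite addn1 -neu_leftE -neu_bottomE; apply: cavg; lia.
- apply: (left_face_eq0 (S := fun _ _ => True) bdu) => // nu m _ h1 h2.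
  rewrite -neu_leftE.
  by apply: (cface _ _ _ _ _).1; rewrite /even_range; lia.
- apply: (bottom_face_eq0 (S := fun _ _ => True) bdu) => // nu m _ h1 h2.
  rewrite -neu_bottomE.
  by apply: (cface _ _ _ _ _).2; rewrite /even_range; lia.
Qed.

(** The bottom face settles odd-odd, the left face even-even, and both together even-odd. *)
Lemma DN_parity p hx hy U u : 0 < hx -> 0 < hy -> in_Vp p u ->
  DN_constraints p hx hy U u -> has_parity true false u.
Proof.
move=> hx0 hy0 /in_Vp_deriv_bounded bdu [_ cleft cbottom cavg ctop].
apply: has_parityP => -[] [] //= _ k l.
- apply: (bottom_face_eq0 (S := fun _ _ => True) bdu) => // nu m _ h1 h2.
  by rewrite -neu_bottomE; apply: cbottom; rewrite /odd_range; lia.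
- apply: (both_faces_eq0 hx0 hy0 bdu) => [nu m lt h1 h2|nu m lt h1 h2|nu h1 h2].
  + by rewrite -dir_leftE; apply: cleft; rewrite /even_range; lia.
  + by rewrite -neu_bottomE; apply: cbottom; rewrite /odd_range; lia.
  + by rewrite addn0 addn1 -dir_leftE -neu_bottomE; apply: cavg; lia.
- apply: (left_face_eq0 (S := fun _ _ => True) bdu) => // nu m _ h1 h2.
  (* Even x-orders reach [2 * p], so the extra constraints of level [p] enter here. *)
  rewrite -dir_leftE; have [->|nup] := eqVneq nu p.
    by apply: ctop; lia.
  by apply: cleft; rewrite /even_range; lia.
Qed.

(** * Reflection of the ghost values *)

Definition ghost_parity (b1 b2 : bool) (p : nat) (U : int -> int -> R) :=
  [/\ forall i j : nat, (1 <= i <= p)%N -> (j <= p - 1)%N ->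
        U (- i%:Z) j%:Z = (-1) ^+ b1 * U i%:Z j%:Z,
      forall i j : nat, (i <= p - 1)%N -> (1 <= j <= p)%N ->
        U i%:Z (- j%:Z) = (-1) ^+ b2 * U i%:Z j%:Z
    & forall i j : nat, (1 <= i <= p)%N -> (1 <= j <= p)%N ->
        U (- i%:Z) (- j%:Z) = (-1) ^+ b1 * ((-1) ^+ b2 * U i%:Z j%:Z)].

(** The booleans, read as 0 or 1, are also the first interpolated indices. On a skipped Dirichlet
    line the polynomial vanishes by oddness and [U] by its boundary data, so they agree on the whole
    square from 0 to [p], which is then reflected. *)
Lemma has_parity_ghost b1 b2 p hx hy (U : int -> int -> R) u :
    (1 <= p)%N -> has_parity b1 b2 u ->
    (forall i j : nat, (b1 <= i <= p)%N -> (b2 <= j <= p)%N ->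
       grid_val hx hy u i%:Z j%:Z = U i%:Z j%:Z) ->
    (b1 -> forall j : nat, (j <= p)%N -> U 0 j%:Z = 0) ->
    (b2 -> forall i : nat, (i <= p)%N -> U i%:Z 0 = 0) ->
    (forall i j : int, - p%:Z <= i <= p%:Z - 1 -> - p%:Z <= j <= p%:Z - 1 ->
       (i < 0) || (j < 0) -> U i j = grid_val hx hy u i j) ->
  ghost_parity b1 b2 p U.
Proof.
move=> p1 pu interp U0x U0y ghost.
have gridNx i j :
    grid_val hx hy u (- i) j = (-1) ^+ b1 * grid_val hx hy u i j.
  by rewrite /grid_val rmorphN mulNr (eval2_parity_x _ _ pu).
have gridNy i j :
    grid_val hx hy u i (- j) = (-1) ^+ b2 * grid_val hx hy u i j.
  by rewrite /grid_val rmorphN mulNr (eval2_parity_y _ _ pu).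
have oppr_id_eq0 (x : R) : x = - x -> x = 0.
  by move=> /esym/eqP; rewrite eqNr => /eqP.
have gridU (i j : nat) : (i <= p)%N -> (j <= p)%N ->
    grid_val hx hy u i%:Z j%:Z = U i%:Z j%:Z.
  move=> ip jp.
  have [/andP[b1T /eqP i0]|i0] := boolP (b1 && (i == 0%N)).
    rewrite i0 U0x //; apply: oppr_id_eq0.
    by have := gridNx 0 j%:Z; rewrite oppr0 b1T expr1 mulN1r.
  have [/andP[b2T /eqP j0]|j0] := boolP (b2 && (j == 0%N)).
    rewrite j0 U0y //; apply: oppr_id_eq0.
    by have := gridNy i%:Z 0; rewrite oppr0 b2T expr1 mulN1r.
  by apply: interp; lia.
split=> i j hi hj; rewrite ghost ?gridNx ?gridNy ?gridU //; lia.
Qed.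

Lemma ghost_parity_swap b1 b2 p (U : int -> int -> R) :
  ghost_parity b1 b2 p (fun i j => U j i) -> ghost_parity b2 b1 p U.
Proof.
move=> [gl gb gc]; split=> i j hi hj.
- exact: gb.
- exact: gl.
- by rewrite gc // mulrCA.
Qed.

(** Dirichlet means odd in the normal variable, so this is the exponent of the reflection sign. *)
Definition is_dirichlet (b : bc) : bool :=
  if b is Dirichlet then true else false.

Lemma lcbc_corner_parity bL bB p hx hy (U : int -> int -> R) :
    (1 <= p)%N -> 0 < hx -> 0 < hy ->
    zero_dirichlet bL bB p U -> lcbc_corner bL bB p hx hy U ->
  ghost_parity (is_dirichlet bL) (is_dirichlet bB) p U.
Proof.
move=> p1 hx0 hy0; case: bL bB => [] [] [zx zy] [u [Vu Cu gu]].
- have [interp _ _] := Cu.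
  by apply: has_parity_ghost (DD_parity hx0 hy0 Vu Cu) interp _ _ gu => // _;
    [exact: zx | exact: zy].
- have [interp _ _ _ _] := Cu.
  by apply: has_parity_ghost (DN_parity hx0 hy0 Vu Cu) interp _ _ gu => // _;
    exact: zx.
(* Interchanging the axes reduces this corner to the previous case, with the spacings interchanged
   too. *)
- have [interp _ _ _ _] := Cu; apply: ghost_parity_swap.
  by apply: has_parity_ghost (DN_parity hy0 hx0 Vu Cu) interp _ _ gu => // _;
    exact: zy.
- have [interp _ _] := Cu.
  by apply: has_parity_ghost (NN_parity hx0 hy0 Vu Cu) interp _ _ gu.
Qed.

End Parity.

Theorem theorem4 (R : realType) (p : nat) (hp : (1 <= p)%N)
    (hx hy : R) (hx0 : 0 < hx) (hy0 : 0 < hy)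
    (bL bB : bc) (U : int -> int -> R)
    (hU0 : zero_dirichlet bL bB p U)
    (hU : lcbc_corner bL bB p hx hy U) :
  [/\ (* left face *)
      forall i j : nat, (1 <= i <= p)%N -> (j <= p - 1)%N ->
        (bL = Dirichlet -> U (- i%:Z) j%:Z = - U i%:Z j%:Z) /\
        (bL = Neumann -> U (- i%:Z) j%:Z = U i%:Z j%:Z),
      (* bottom face *)
      forall i j : nat, (i <= p - 1)%N -> (1 <= j <= p)%N ->
        (bB = Dirichlet -> U i%:Z (- j%:Z) = - U i%:Z j%:Z) /\
        (bB = Neumann -> U i%:Z (- j%:Z) = U i%:Z j%:Z)
    & (* corner ghost points *)
      forall i j : nat, (1 <= i <= p)%N -> (1 <= j <= p)%N ->
        (bL = bB -> U (- i%:Z) (- j%:Z) = U i%:Z j%:Z) /\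
        (bL <> bB -> U (- i%:Z) (- j%:Z) = - U i%:Z j%:Z)].
Proof.
have [gl gb gc] := lcbc_corner_parity hp hx0 hy0 hU0 hU.
split=> i j hi hj.
- by rewrite gl //; split=> ->; rewrite ?expr0 ?expr1 ?mul1r ?mulN1r.
- by rewrite gb //; split=> ->; rewrite ?expr0 ?expr1 ?mul1r ?mulN1r.
(* The two reflection signs cancel exactly when the faces carry the same condition. *)
- rewrite gc //; case: bL bB {hU0 hU gl gb gc} => [] [].
  all: by split=> // _; rewrite /= ?expr0 ?expr1 ?mulN1r ?mul1r ?opprK.
Qed.
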